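(* Let $k\geq 3$ and let $0<c<\frac{1}{k(k-1)}$. Then there exists $\gamma>0$ such that, with probability $1-o(1)$ as $n\to\infty$, a random instance $\Phi$ of 1-in-$k$ SAT with $n$ variables and $cn$ clauses has the property that every two satisfying assignments of $\Phi$ are $\lfloor\gamma\log n\rfloor$-connected.
   Context: An instance of 1-in-$k$ SAT is a conjunction of clauses, each consisting of exactly $k$ literals on $k$ distinct variables from $x_1,\dots,x_n$; an assignment $A\in\{0,1\}^n$ satisfies the instance if in every clause exactly one literal is true. A random instance with $n$ variables and $cn$ clauses consists of $cn$ clauses, each chosen independently and uniformly at random from the $2^k\binom{n}{k}$ possible clauses (a set of $k$ distinct variables together with a choice of sign for each). For an integer $l\geq 1$, two satisfying assignments $A,B$ of $\Phi$ are $l$-connected if there is a sequence of satisfying assignments $A_0=A,A_1,\dots,A_r=B$ of $\Phi$ such that $A_i$ and $A_{i+1}$ are at Hamming distance at most $l$ for every $i$. *)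

(* Defs.v *)
From Stdlib Require Import Reals.
From HB Require Import structures.
From mathcomp Require Import all_boot.
Set Implicit Arguments. Unset Strict Implicit. Unset Printing Implicit Defensive.

(* A literal on variables x_0..x_{n-1}: (i, b) is x_i if b = true, ~x_i if b = false. *)
Definition lit (n : nat) := ('I_n * bool)%type.

Definition is_clause (n k : nat) (S : {set lit n}) : bool :=
  (#|S| == k) && [forall x in S, forall y in S, (x.1 == y.1) ==> (x == y)].

Definition clause (n k : nat) := {S : {set lit n} | is_clause k S}.

Definition assignment (n : nat) := {ffun 'I_n -> bool}.

Definition lit_true n (A : assignment n) (l : lit n) : bool := A l.1 == l.2.

Definition one_in_k_sat n k (A : assignment n) (C : clause n k) : bool :=
  #|[set l in val C | lit_true A l]| == 1.

(* an instance with m clauses: an m-tuple (ordered, independent draws) *)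
Definition instance (n k m : nat) := {ffun 'I_m -> clause n k}.

Definition satisfies n k m (Phi : instance n k m) (A : assignment n) : bool :=
  [forall j, one_in_k_sat A (Phi j)].

Definition hamming n (A B : assignment n) : nat := #|[set i | A i != B i]|.

Definition step n k m (Phi : instance n k m) (l : nat) : rel (assignment n) :=
  fun A B => [&& satisfies Phi A, satisfies Phi B & hamming A B <= l].

Definition l_connected n k m (Phi : instance n k m) (l : nat) (A B : assignment n) : bool :=
  connect (step Phi l) A B.

Definition all_sat_connected n k m (Phi : instance n k m) (l : nat) : bool :=
  [forall A : assignment n, forall B : assignment n,
     satisfies Phi A ==> satisfies Phi B ==> l_connected Phi l A B].

Definition prob_connected (n k m l : nat) : R :=
  Rdiv (INR #|[set Phi : instance n k m | all_sat_connected Phi l]|)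
       (INR #|{: instance n k m}|).

Definition floorR (x : R) : nat := Z.to_nat (Int_part x).

(* Main.v *)
(* Explore the component of a variable [v] in the hypergraph of clauses, one variable at a time.
   Given the clauses already met, the remaining ones are independent and uniform among the clauses
   avoiding the explored set [U], so each of them contains the next variable with probability at
   most [k / (n - #|U|)].  This bounds an exponential moment of the number of clauses met in [l + 1]
   steps.  An exploration that survives [l + 1] steps has met at least [l / (k - 1)] clauses, so when
   [c k (k - 1) < 1] a Chernoff bound makes survival exponentially unlikely in [l], and a union
   bound over [v] allows [l = gamma ln n].  When no exploration survives, every variable lies in a
   set of at most [l] variables that is a union of components; a satisfying assignment can be
   turned into another one by overwriting such sets one after the other. *)
Require Import Defs.
From Stdlib Require Import Reals Lra ZArith.
From HB Require Import structures.
From mathcomp Require Import all_boot.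
From mathcomp Require Import all_order perm all_algebra.
From mathcomp Require Import Rstruct.
Set Implicit Arguments. Unset Strict Implicit. Unset Printing Implicit Defensive.
Import Order.TTheory GRing.Theory Num.Theory.

(** * Exploring the component of a vertex in a family of edges *)

Section Exploration.
Variables (V T I : finType) (e : T -> {set V}).
Implicit Types (U : {set V}) (C : T) (Phi Psi : {ffun I -> T}) (u v : V).

Definition hits U C := ~~ [disjoint e C & U].

Definition nhit U Phi := #|[set j | hits U (Phi j)]|.

Definition reach v U Phi := v |: \bigcup_(j | hits U (Phi j)) e (Phi j).

(** The vertex picked is a function of [reach v U Phi :\: U], hence of [v], [U] and the edges
    meeting [U] only. When nothing new is reached, the exploration stalls at [U] for good. *)
Definition next v U Phi :=
  if [pick u in reach v U Phi :\: U] is Some u then u |: U else U.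

Definition explored v t Phi := iter t (fun U => next v U Phi) set0.

(* [Psi] is compatible with everything learnt about [Phi] by exploring [U]. *)
Definition agree U Phi Psi :=
  [forall j, if hits U (Phi j) then Psi j == Phi j else ~~ hits U (Psi j)].

Lemma hitsU1 u U C : hits (u |: U) C = (u \in e C) || hits U C.
Proof.
rewrite /hits -!setI_eq0 setIUr setU_eq0 negb_and; congr (_ || _).
by rewrite setI_eq0 disjoint_sym disjoints1 negbK; reflexivity.
Qed.

Lemma hits_sub U U' C : U \subset U' -> hits U C -> hits U' C.
Proof. by move=> sUU'; apply: contra; apply: disjointWr. Qed.

Lemma hits0 C : hits set0 C = false.
Proof. by rewrite /hits -setI_eq0 setI0 eqxx. Qed.

Lemma nextP v U Phi :
  (reach v U Phi \subset U /\ next v U Phi = U) \/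
  exists u, [/\ u \in reach v U Phi, u \notin U & next v U Phi = u |: U].
Proof.
rewrite /next; case: pickP => [u|none].
  by rewrite in_setD => /andP[uU ur]; right; exists u.
by left; split=> //; rewrite -setD_eq0; apply/eqP/setP => u; rewrite none inE.
Qed.

Lemma agree_hits U Phi Psi j : agree U Phi Psi -> hits U (Psi j) = hits U (Phi j).
Proof. by move=> /forallP/(_ j); case: ifP => [h /eqP->|_ /negbTE]. Qed.

Lemma agree_eq U Phi Psi j : agree U Phi Psi -> hits U (Phi j) -> Psi j = Phi j.
Proof. by move=> /forallP/(_ j); case: ifP => // _ /eqP. Qed.

Lemma agree_refl U Phi : agree U Phi Phi.
Proof. by apply/forallP => j; case: ifP => // ->. Qed.

Lemma agree_sym U Phi Psi : agree U Phi Psi = agree U Psi Phi.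
Proof.
wlog suff: Phi Psi / agree U Phi Psi -> agree U Psi Phi.
  by move=> h; apply/idP/idP; apply: h.
move=> a; apply/forallP => j; rewrite (agree_hits j a).
by case: ifP => [h|->//]; rewrite (agree_eq a h).
Qed.

Lemma agree_trans U : transitive (agree U).
Proof.
move=> Psi Phi Xi a b; apply/forallP => j; case: ifP => h.
  by rewrite -(agree_eq a h) (agree_eq b) ?(agree_hits j a).
by rewrite (agree_hits j b) (agree_hits j a) h.
Qed.

Lemma agree_sub U U' Phi Psi : U \subset U' -> agree U' Phi Psi -> agree U Phi Psi.
Proof.
move=> sUU' a; apply/forallP => j; case: ifP => h.
  by rewrite (agree_eq a) // (hits_sub sUU').
apply/negP => h'; have := hits_sub sUU' h'; rewrite (agree_hits j a) => h2.
by move: h'; rewrite (agree_eq a h2) h.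
Qed.

Lemma agree_next v U Phi Psi : agree U Phi Psi -> next v U Psi = next v U Phi.
Proof.
move=> a; suff r : reach v U Psi = reach v U Phi by rewrite /next r.
rewrite /reach; congr (_ |: _).
rewrite (eq_bigl _ _ (fun j => agree_hits j a)).
by apply: eq_bigr => j h; rewrite (agree_eq a h).
Qed.

Lemma exploredS v t Phi : explored v t.+1 Phi = next v (explored v t Phi) Phi.
Proof. by []. Qed.

Lemma sub_next v U Phi : U \subset next v U Phi.
Proof. by case: (nextP v U Phi) => [[_ ->]|[u [_ _ ->]]] //; exact: subsetUr. Qed.

(** Each step consults only edges that meet the set explored so far, so these edges determine the
    whole exploration. Hence, for fixed [v] and [t], the classes of [agree (explored v t Phi) Phi]
    partition all families. *)
Lemma agree_explored v t Phi Psi :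
  agree (explored v t Phi) Phi Psi -> explored v t Psi = explored v t Phi.
Proof.
elim: t => // t IHt; rewrite !exploredS => a.
have a' := agree_sub (sub_next _ _ _) a.
by rewrite (IHt a') (agree_next _ a').
Qed.

Lemma explored_dichotomy v t Phi :
  #|explored v t Phi| = t \/ reach v (explored v t Phi) Phi \subset explored v t Phi.
Proof.
elim: t => [|t IHt]; first by left; rewrite cards0.
rewrite exploredS; set U := explored v t Phi in IHt *.
case: (nextP v U Phi) => [[r ->]|[u [ur uU ->]]]; first by right.
case: IHt => [<-|r]; first by left; rewrite cardsU1 uU.
by move: uU; rewrite (subsetP r).
Qed.

Lemma card_explored v t Phi : #|explored v t Phi| <= t.
Proof.
elim: t => [|t IHt]; first by rewrite cards0.
rewrite exploredS; set U := explored v t Phi in IHt *.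
case: (nextP v U Phi) => [[r ->]|[u [ur uU ->]]]; first exact: leqW.
by rewrite cardsU1 uU.
Qed.

Lemma reach_sub v U U' Phi : U \subset U' -> reach v U Phi \subset reach v U' Phi.
Proof.
move=> s; apply: setUS; apply/bigcupsP => j h.
by apply: (bigcup_max j) => //; apply: hits_sub h.
Qed.

Lemma explored_reach v t Phi : explored v t Phi \subset reach v (explored v t Phi) Phi.
Proof.
elim: t => [|t IHt]; first exact: sub0set.
rewrite exploredS; set U := explored v t Phi in IHt *.
case: (nextP v U Phi) => [[r ->]//|[u [ur uU ->]]].
have s := reach_sub v Phi (subsetUr [set u] U).
by rewrite subUset sub1set (subsetP s) //= (subset_trans IHt).
Qed.

Lemma nhitU1 u U Phi :
  nhit (u |: U) Phi = nhit U Phi + #|[set j | ~~ hits U (Phi j) & u \in e (Phi j)]|.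
Proof.
rewrite /nhit -cardsUI [X in _ = _ + X](_ : _ = 0) ?addn0.
  congr #|pred_of_set _|; apply/setP => j; rewrite !inE hitsU1 orbC.
  by case: hits.
by apply/eqP; rewrite cards_eq0; apply/eqP/setP => j; rewrite !inE; case: hits.
Qed.

(** * Vertices reached against edges met *)

Section Uniform.
Variable k : nat.
Hypothesis card_e : forall C, #|e C| = k.

(* Every newly hit edge contains [u], which is already reached, and so adds at most [k - 1] vertices. *)
Lemma card_reachU1 v u U Phi : u \in reach v U Phi ->
  #|reach v (u |: U) Phi| + k.-1 * nhit U Phi <=
  #|reach v U Phi| + k.-1 * nhit (u |: U) Phi.
Proof.
move=> ur; rewrite nhitU1 mulnDr addnCA [leqLHS]addnC leq_add2l.
set J := [set j | _ & _].
have s : reach v (u |: U) Phi \subset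
    reach v U Phi :|: \bigcup_(j in J) (e (Phi j) :\ u).
  apply/subsetP => w; case: (eqVneq w u) => [->|wu]; first by rewrite in_setU ur.
  rewrite in_setU1 => /orP[/eqP->|/bigcupP[j]]; first by rewrite in_setU setU11.
  rewrite hitsU1 => hj wj; case: (boolP (hits U (Phi j))) => h.
    by apply/setUP; left; apply/setUP; right; apply/bigcupP; exists j.
  move: hj; rewrite (negbTE h) orbF => uj.
  by apply/setUP; right; apply/bigcupP; exists j; rewrite !inE ?h // wu.
apply: leq_trans (subset_leq_card s) _.
apply: leq_trans (leq_card_setU _ _) _; rewrite leq_add2l.
rewrite mulnC -sum_nat_const; elim/big_rec2: _ => [|j q W jJ IH]; first by rewrite cards0.
apply: leq_trans (leq_card_setU _ _) (leq_add _ IH).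
by move: jJ; rewrite inE => /andP[_ uj]; rewrite -(card_e (Phi j)) (cardsD1 u (e _)) uj.
Qed.

(** At the start only [v] is reached, which accounts for the successor; then [card_reachU1] is
    accumulated over the steps. *)
Lemma card_reach v t Phi :
  #|reach v (explored v t Phi) Phi| <= (k.-1 * nhit (explored v t Phi) Phi).+1.
Proof.
elim: t => [|t IHt].
  rewrite /reach big1 ?setU0 ?cards1 // => j.
  by rewrite hits0.
rewrite exploredS; set U := explored v t Phi in IHt *.
case: (nextP v U Phi) => [[r ->]//|[u [ur uU ->]]].
rewrite -(leq_add2r (k.-1 * nhit U Phi)); apply: leq_trans (card_reachU1 ur) _.
by rewrite addSn addnC -addnS leq_add2l.
Qed.

Lemma card_explored_nhit v t Phi :
  #|explored v t Phi| <= (k.-1 * nhit (explored v t Phi) Phi).+1.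
Proof. by apply: leq_trans (card_reach v t Phi); apply/subset_leq_card/explored_reach. Qed.

End Uniform.

(** * Exponential moment of the number of edges met *)

Section ExponentialMoment.
Local Open Scope ring_scope.
Variables (F : realFieldType) (z p : F) (l : nat).
Hypotheses (z_ge1 : 1 <= z) (p_ge0 : 0 <= p).
Hypothesis degree_bound : forall U u, (#|U| <= l)%N -> u \notin U ->
  #|[set C | ~~ hits U C & u \in e C]|%:R <= p * #|[set C | ~~ hits U C]|%:R.

(** Bounds the mean weight, after one more vertex is explored, of an edge uniform among those not
    yet met: [z] with probability at most [p], and 1 otherwise. *)
Let b := 1 + (z - 1) * p.

Let b_ge1 : 1 <= b.
Proof. by rewrite lerDl mulr_ge0 ?subr_ge0. Qed.

Lemma expr_nhit U Phi : z ^+ nhit U Phi = \prod_j (if hits U (Phi j) then z else 1).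
Proof.
rewrite -big_mkcond prodr_const; congr (_ ^+ _).
by apply: eq_card => j; rewrite !inE.
Qed.

(* The class of [Phi] is a product set, so the weights factor over the index [j]. *)
Lemma sum_agree U Phi W :
  \sum_(Psi | agree U Phi Psi) z ^+ nhit W Psi =
  \prod_j \sum_(C | if hits U (Phi j) then C == Phi j else ~~ hits U C)
    (if hits W C then z else 1).
Proof.
rewrite bigA_distr_big_dep; apply: eq_big => [Psi|Psi _]; last exact: expr_nhit.
by apply: eq_forallb => j; rewrite unfold_in.
Qed.

(** The two products are compared index by index. An edge already met has the same sum on both
    sides, and [1 <= b]; an unmet one gives [#|D| + (z - 1) * #|H|] against [b * #|D|], which is
    [degree_bound]. *)
Lemma sum_agree_U1 U u Phi : (#|U| <= l)%N -> u \notin U ->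
  \sum_(Psi | agree U Phi Psi) z ^+ nhit (u |: U) Psi <=
  b ^+ #|I| * \sum_(Psi | agree U Phi Psi) z ^+ nhit U Psi.
Proof.
move=> lU uU; have z_ge0 : 0 <= z := le_trans ler01 z_ge1.
rewrite !sum_agree -prodr_const -big_split /=; apply: ler_prod => j _.
apply/andP; split; first by apply: sumr_ge0 => C _; case: ifP.
case: (boolP (hits U (Phi j))) => h /=.
  rewrite !big_pred1_eq h (hits_sub (subsetUr _ _) h).
  by rewrite ler_peMl.
set D := [set C | ~~ hits U C]; set H := [set C | ~~ hits U C & u \in e C].
have -> : \sum_(C | ~~ hits U C) (if hits U C then z else 1) = #|D|%:R.
  rewrite -sumr_const big_mkcond [RHS]big_mkcond /=; apply: eq_bigr => C _.
  by rewrite inE; case: hits.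
have -> : \sum_(C | ~~ hits U C) (if hits (u |: U) C then z else 1) =
    #|D|%:R + (z - 1) * #|H|%:R.
  rewrite -!sumr_const mulr_sumr big_mkcond [X in X + _]big_mkcond.
  rewrite [X in _ + X]big_mkcond -big_split; apply: eq_bigr => C _ /=.
  rewrite !inE hitsU1; case: hits => /=; rewrite ?addr0 // orbF.
  by case: (u \in e C); rewrite ?addr0 // mulr1 addrC subrK.
rewrite /b [leRHS]mulrDl mul1r lerD2l -mulrA ler_wpM2l ?subr_ge0 //.
exact: degree_bound.
Qed.

Lemma expr_nhit_explored v t : (t <= l.+1)%N ->
  \sum_Phi z ^+ nhit (explored v t Phi) Phi <=
  b ^+ (#|I| * t) * #|{: {ffun I -> T}}|%:R.
Proof.
elim: t => [_|t IHt tl].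
  rewrite muln0 mul1r -sumr_const; apply: ler_sum => Phi _.
  rewrite (_ : nhit _ _ = 0%N) //; apply/eqP; rewrite cards_eq0.
  by apply/eqP/setP => j; rewrite !inE hits0.
have bge0 n : 0 <= b ^+ n by rewrite exprn_ge0 // (le_trans ler01 b_ge1).
rewrite mulnS exprD -mulrA.
apply: le_trans _ (ler_wpM2l (bge0 _) (IHt (ltnW tl))).
(* Conditioning on the history: on each class the set explored after [t] steps and the next vertex
   are constant, so the one-step bound applies class by class. *)
pose cls Phi := [set Psi | agree (explored v t Phi) Phi Psi].
rewrite mulr_sumr (partition_big cls xpredT) //=.
rewrite [leRHS](partition_big cls xpredT) //=; apply: ler_sum => P _.
case: (pickP (fun Phi => cls Phi == P)) => [Phi /eqP<-|none]; last first.
  by rewrite !big_pred0.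
set U := explored v t Phi.
have clsE Psi : (cls Psi == cls Phi) = agree U Phi Psi.
  apply/eqP/idP => [ePsi|a].
    have : Psi \in cls Psi by rewrite inE agree_refl.
    by rewrite ePsi inE.
  apply/setP => Xi; rewrite !inE (agree_explored a) -/U.
  by apply/idP/idP; apply: agree_trans => //; rewrite agree_sym.
rewrite (eq_bigl _ _ clsE) [leRHS](eq_bigl _ _ clsE) -mulr_sumr.
have -> : \sum_(Psi | agree U Phi Psi) z ^+ nhit (explored v t Psi) Psi =
    \sum_(Psi | agree U Phi Psi) z ^+ nhit U Psi.
  by apply: eq_bigr => Psi a; rewrite (agree_explored a).
have -> : \sum_(Psi | agree U Phi Psi) z ^+ nhit (explored v t.+1 Psi) Psi =
    \sum_(Psi | agree U Phi Psi) z ^+ nhit (next v U Phi) Psi.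
  by apply: eq_bigr => Psi a; rewrite exploredS (agree_explored a) (agree_next _ a).
case: (nextP v U Phi) => [[_ ->]|[u [_ uU ->]]].
  rewrite ler_peMl ?exprn_ege1 // sumr_ge0 // => Psi _.
  by rewrite exprn_ge0 // (le_trans ler01 z_ge1).
apply: sum_agree_U1 => //.
by apply: leq_trans (card_explored v t Phi) _; rewrite -ltnS.
Qed.

End ExponentialMoment.

(* Weighting each hit edge by [y ^+ k.-1] makes a full exploration weigh at least [y ^+ l]. *)
Lemma card_explored_full (F : realFieldType) (y p : F) (k l : nat) v :
  (1 <= y)%R -> (0 <= p)%R -> (forall C, #|e C| = k) ->
  (forall U u, (#|U| <= l)%N -> u \notin U ->
    (#|[set C | ~~ hits U C & u \in e C]|%:R <= p * #|[set C | ~~ hits U C]|%:R)%R) ->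
  (#|[set Phi : {ffun I -> T} | #|explored v l.+1 Phi| == l.+1]|%:R * y ^+ l <=
   (1 + (y ^+ k.-1 - 1) * p) ^+ (#|I| * l.+1) * #|{: {ffun I -> T}}|%:R)%R.
Proof.
move=> y1 p0 card_e deg.
apply: le_trans (expr_nhit_explored (exprn_ege1 _ y1) p0 deg v (leqnn _)).
rewrite mulr_natl -sumr_const big_mkcond; apply: ler_sum => Phi _.
rewrite inE -exprM; case: eqP => [full|_]; last by rewrite exprn_ge0 // (le_trans ler01 y1).
apply: ler_weXn2l => //.
by have := card_explored_nhit card_e v l.+1 Phi; rewrite full.
Qed.

End Exploration.

(** * Clauses as edges on the variables *)

Section Clauses.
Variables n k m : nat.
Implicit Types (U : {set 'I_n}) (C : clause n k) (Phi : instance n k m) (A B : assignment n).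

Definition vars C : {set 'I_n} := [set x.1 | x in val C].

Lemma card_vars C : #|vars C| = k.
Proof.
have /andP[/eqP cardC /forall_inP inj] := valP C.
rewrite -[RHS]cardC; apply: card_in_imset => x y xC yC /eqP exy.
by have /forall_inP/(_ y yC)/implyP/(_ exy)/eqP := inj x xC.
Qed.

Definition splice U A B : assignment n := [ffun i => if i \in U then B i else A i].

Lemma eq_one_in_k_sat A B C : {in vars C, A =1 B} -> one_in_k_sat A C = one_in_k_sat B C.
Proof.
move=> AB; rewrite /one_in_k_sat; congr (_ == _); apply: eq_card => x.
rewrite !inE; case: (boolP (x \in val C)) => //= xC.
by rewrite /lit_true AB // imset_f.
Qed.

(** A clause that meets [U] lies inside [U] and sees only [B]; any other clause sees only [A]. *)
Lemma satisfies_splice U A B Phi :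
  (forall j, hits vars U (Phi j) -> vars (Phi j) \subset U) ->
  satisfies Phi A -> satisfies Phi B -> satisfies Phi (splice U A B).
Proof.
move=> closedU /forallP sA /forallP sB; apply/forallP => j.
case: (boolP (hits vars U (Phi j))) => h.
  rewrite (eq_one_in_k_sat (B := B)) // => i ij.
  by rewrite ffunE (subsetP (closedU j h)).
rewrite (eq_one_in_k_sat (B := A)) // => i ij.
by move: h; rewrite negbK ffunE => /disjointFr->.
Qed.

(** Induction on the Hamming distance. From a variable [v] where [A] and [B] differ, the exploration
    stalls at a closed set of at most [l] variables containing [v]. Copying [B] onto it is one legal
    step, and it removes the disagreement at [v] without creating any. *)
Lemma all_sat_connected_explored l Phi :
  (forall v, #|explored vars v l.+1 Phi| != l.+1) -> all_sat_connected Phi l.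
Proof.
move=> small; apply/forallP => A; apply/forallP => B.
apply/implyP => sA; apply/implyP => sB.
have [h] := ubnP (hamming A B); elim: h => // h IHh in A sA *; rewrite ltnS => AB.
case: (pickP (fun i => A i != B i)) => [v vAB|none]; last first.
  have -> : A = B by apply/ffunP => i; apply/eqP; rewrite -[_ == _]negbK none.
  exact: connect0.
set U := explored vars v l.+1 Phi.
have cardU : #|U| <= l by rewrite -ltnS ltn_neqAle small card_explored.
have rU : reach vars v U Phi \subset U.
  by case: (explored_dichotomy vars v l.+1 Phi) => // full; move: (small v); rewrite full eqxx.
have vU : v \in U by rewrite (subsetP rU) // setU11.
have sAB : satisfies Phi (splice U A B).
  apply: satisfies_splice => // j hj; apply: subset_trans rU.
  by apply: subset_trans (subsetUr _ _); apply: (bigcup_sup j).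
apply: connect_trans (connect1 _) (IHh (splice U A B) sAB _).
  rewrite /step sA sAB; apply: leq_trans cardU; apply/subset_leq_card/subsetP => i.
  by rewrite inE ffunE; case: ifP => //; rewrite eqxx.
apply: leq_trans AB; apply: proper_card; apply/properP; split.
  by apply/subsetP => i; rewrite !inE ffunE; case: ifP => //; rewrite eqxx.
by exists v; rewrite !inE ?ffunE ?vU ?eqxx.
Qed.

Definition rename_lits (s : {perm 'I_n}) (S : {set lit n}) : {set lit n} :=
  [set (s x.1, x.2) | x in S].

Lemma rename_lits_clause s C : is_clause k (rename_lits s (val C)).
Proof.
have /andP[/eqP cardC /forall_inP inj] := valP C.
apply/andP; split.
  rewrite card_imset ?cardC // => -[i a] [j b] [] /perm_inj -> -> //.
apply/forall_inP => _ /imsetP[x xC ->]; apply/forall_inP => _ /imsetP[y yC ->] /=.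
apply/implyP => /eqP/perm_inj/eqP exy.
by have /forall_inP/(_ y yC)/implyP/(_ exy)/eqP-> := inj x xC.
Qed.

Definition rename s C : clause n k := Sub (rename_lits s (val C)) (rename_lits_clause s C).

Lemma rename_inj s : injective (rename s).
Proof.
move=> C D /(congr1 val) /= eCD; apply: val_inj.
by apply: (imset_inj _ eCD) => -[i a] [j b] [] /perm_inj -> ->.
Qed.

Lemma vars_rename s C : vars (rename s C) = s @: vars C.
Proof. by rewrite /vars /= /rename_lits -!imset_comp; apply: eq_imset. Qed.

Definition avoiding U := [set C | ~~ hits vars U C].

Definition degree_avoiding U u := #|[set C | ~~ hits vars U C & u \in vars C]|.

(** Swapping [u] and [v] maps clauses containing [u] injectively to clauses containing [v], and it
    fixes [U] pointwise because both lie outside. *)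
Lemma degree_avoiding_le U u v : u \notin U -> v \notin U ->
  degree_avoiding U u <= degree_avoiding U v.
Proof.
move=> uU vU; rewrite /degree_avoiding -(card_imset _ (@rename_inj (tperm u v))).
apply/subset_leq_card/subsetP => _ /imsetP[C + ->].
rewrite !inE /hits !negbK vars_rename => /andP[CU uC]; apply/andP; split; last first.
  by apply/imsetP; exists u; rewrite ?tpermL.
rewrite -setI_eq0; apply/eqP/setP => w; rewrite !inE; apply/negP => /andP[/imsetP[x xC ->]].
case: tpermP => [_|_|_ _]; try by apply/negP.
by rewrite (disjointFr CU).
Qed.

(* Symmetry makes all degrees outside [U] equal, and they add up to [k * #|avoiding U|]. *)
Lemma degree_avoidingE U u : u \notin U ->
  (n - #|U|) * degree_avoiding U u = k * #|avoiding U|.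
Proof.
move=> uU.
have -> : n - #|U| = #|~: U| by rewrite [RHS]cardsCs setCK card_ord.
rewrite -sum_nat_const mulnC -sum_nat_const.
have -> : \sum_(v in ~: U) degree_avoiding U u = \sum_(v in ~: U) degree_avoiding U v.
  apply: eq_bigr => v; rewrite inE => vU.
  by apply/eqP; rewrite eqn_leq !degree_avoiding_le.
(* Double counting of the pairs of a variable and a clause avoiding [U] that contains it. *)
under eq_bigr => v _ do rewrite /degree_avoiding -sum1_card.
rewrite (exchange_big_dep (mem (avoiding U))) /=; last first.
  by move=> v C _; rewrite !inE => /andP[].
apply: eq_bigr => C; rewrite inE => CU.
rewrite -[RHS](card_vars C) -sum1_card; apply: eq_bigl => v.
rewrite !inE CU /=; case: (boolP (v \in vars C)) => vC; rewrite ?andbF // andbT.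
by move: CU; rewrite negbK => /disjointFr->.
Qed.

(** Makes the number of instances, the denominator of the probability, positive. The witness has the
    first [k] variables, all unnegated. *)
Lemma clause_inhabited : k <= n -> 0 < #|{: clause n k}|.
Proof.
move=> kn; pose S : {set lit n} := [set (widen_ord kn i, true) | i in [set: 'I_k]].
suff cS : is_clause k S by apply/card_gt0P; exists (Sub S cS).
apply/andP; split.
  rewrite card_imset ?cardsT ?card_ord // => i j [] /eqP ij; exact/ord_inj/eqP.
apply/forall_inP => _ /imsetP[i _ ->]; apply/forall_inP => _ /imsetP[j _ ->] /=.
by apply/implyP => /eqP->.
Qed.

End Clauses.

(** Union bound over the starting variable. While at most [l] variables are explored, at least
    [n - l] remain, so [degree_avoidingE] allows [p = k / (n - l)]. *)
Lemma card_disconnected (F : realFieldType) (n k m l : nat) (y : F) :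
  l < n -> (1 <= y)%R ->
  (#|[set Phi : instance n k m | ~~ all_sat_connected Phi l]|%:R * y ^+ l <=
   n%:R * (1 + (y ^+ k.-1 - 1) * (k%:R / (n - l)%:R)) ^+ (m * l.+1)
     * #|{: instance n k m}|%:R)%R.
Proof.
move=> ln y1.
have nl0 : (0 < (n - l)%:R :> F)%R by rewrite ltr0n subn_gt0.
pose full v := [set Phi : instance n k m | #|explored (@vars n k) v l.+1 Phi| == l.+1].
have sub : [set Phi : instance n k m | ~~ all_sat_connected Phi l] \subset \bigcup_v full v.
  apply/subsetP => Phi; rewrite inE; apply: contraR => none.
  apply: all_sat_connected_explored => v; apply: contra none => fv.
  by apply/bigcupP; exists v; rewrite ?inE.
have bound : #|\bigcup_v full v| <= \sum_v #|full v|.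
  elim/big_rec2: _ => [|v q W _ IH]; first by rewrite cards0.
  exact: leq_trans (leq_card_setU _ _) (leq_add _ IH).
have := leq_trans (subset_leq_card sub) bound.
rewrite -(ler_nat F) natr_sum => /(ler_wpM2r (exprn_ge0 l (le_trans ler01 y1))) le1.
apply: le_trans le1 _; rewrite mulr_suml -mulrA mulr_natl -[X in (_ <= _ *+ X)%R](card_ord n) -sumr_const.
apply: ler_sum => v _.
rewrite -[X in X * _](card_ord m).
apply: (@card_explored_full _ _ _ (@vars n k) F y _ k l v) => //.
- by rewrite divr_ge0 ?ler0n // ltW.
- exact: card_vars.
move=> U u Ul uU; rewrite mulrAC ler_pdivlMr // -!natrM ler_nat mulnC.
rewrite -(degree_avoidingE k uU); apply: leq_mul => //.
exact: leq_sub2l.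
Qed.

(** * Chernoff bound over the reals *)

Section Asymptotics.
Local Open Scope R_scope.

Lemma prob_disconnected (n k m l : nat) (y : R) : (k <= n)%N -> (l < n)%N -> 1 <= y ->
  (1 - prob_connected n k m l) * y ^ l <=
  INR n * (1 + (y ^ k.-1 - 1) * (INR k / INR (n - l))) ^ (m * l.+1)%N.
Proof.
move=> kn ln /RleP y1.
have /RleP := card_disconnected k m ln y1.
rewrite /prob_connected; set G := [set Phi | all_sat_connected Phi l].
set D := [set Phi | _]; set t := #|{: instance n k m}|.
have t0 : 0 < INR t.
  apply: (lt_INR 0); apply/ssrnat.ltP; rewrite /t card_ffun expn_gt0.
  by rewrite clause_inhabited.
have Dt : INR #|D| = INR t - INR #|G|.
  rewrite /t -(cardsC G) plus_INR (_ : D = ~: G); first by ring.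
  by apply/setP => Phi; rewrite !inE.
rewrite -!INRE -!RpowE => le.
(* The ring operations and order on [R] unfold to those of Stdlib, so this restatement holds by
   conversion. *)
have {}le : INR #|D| * y ^ l <=
    INR n * (1 + (y ^ k.-1 - 1) * (INR k / INR (n - l))) ^ (m * l.+1)%N * INR t by [].
apply: (Rmult_le_reg_r (INR t)) => //.
apply: Rle_trans le; apply: Req_le; rewrite Dt; field; lra.
Qed.

Lemma prob_connected_le1 (n k m l : nat) : (k <= n)%N -> prob_connected n k m l <= 1.
Proof.
move=> kn; have t0 : 0 < INR #|{: instance n k m}|.
  apply: (lt_INR 0); apply/ssrnat.ltP; rewrite card_ffun expn_gt0.
  by rewrite clause_inhabited.
apply: (Rmult_le_reg_r (INR #|{: instance n k m}|)) => //.
rewrite /prob_connected /Rdiv Rmult_assoc Rinv_l ?Rmult_1_r ?Rmult_1_l; last lra.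
by apply/le_INR/ssrnat.leP/max_card.
Qed.

Lemma exp_pow (x : R) (n : nat) : exp x ^ n = exp (x * INR n).
Proof.
elim: n => [|n IHn]; first by rewrite Rmult_0_r exp_0.
by rewrite /= IHn -exp_plus; congr exp; rewrite -/(INR n.+1) S_INR; ring.
Qed.

Lemma pow_le_exp (x : R) (n : nat) : 0 <= x -> (1 + x) ^ n <= exp (x * INR n).
Proof.
move=> x0; rewrite -exp_pow; apply: pow_incr; split; first lra.
exact: exp_ineq1_le.
Qed.

(** Rearranges [1 - x <= exp (- x)]; the rational bound lets the constants be chosen
    algebraically. *)
Lemma exp_sub1_le (x : R) : x < 1 -> exp x - 1 <= x / (1 - x).
Proof.
move=> x1; have := exp_ineq1_le (- x); rewrite exp_Ropp => h.
have e0 := exp_pos x.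
have : exp x * (1 - x) <= 1.
  apply: (Rmult_le_reg_r (/ exp x)); first exact: Rinv_0_lt_compat.
  rewrite Rmult_1_l (_ : exp x * (1 - x) * / exp x = 1 - x); [lra|field; lra].
move=> h2; apply: (Rmult_le_reg_r (1 - x)); first lra.
rewrite (_ : x / (1 - x) * (1 - x) = x); [lra|field; lra].
Qed.

Lemma floorR_bounds (x : R) : 0 <= x -> x - 1 <= INR (floorR x) <= x.
Proof.
move=> x0; have [h1 h2] := base_Int_part x.
have pos : Z.le 0 (Int_part x).
  by apply/Z.lt_succ_r; apply: lt_IZR; rewrite succ_IZR; lra.
rewrite /floorR INR_IZR_INZ Z2Nat.id //; lra.
Qed.

Lemma ln_le_2sqrt (x : R) : 0 < x -> ln x <= 2 * sqrt x.
Proof.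
move=> x0; have s0 := sqrt_lt_R0 x x0.
rewrite -{1}(sqrt_sqrt x) ?ln_mult //; last lra.
have : ln (sqrt x) <= sqrt x; last lra.
have := exp_ineq1_le (ln (sqrt x)); rewrite exp_ln //; lra.
Qed.


(** Take [y = exp (theta / (k - 1))], so that [y ^ (k - 1) = exp theta]. The exponent weighs a
    growth of [beta] per step against a gain of [theta / (k - 1)]; [rho] absorbs the loss from [n]
    to [n - l]. *)
Lemma prob_connected_ge (n k m l : nat) (c theta rho : R) :
  (1 < k)%N -> (k <= n)%N -> (l < n)%N -> 0 < c -> 0 < theta < 1 -> 
  INR m <= c * INR n -> INR n <= rho * INR (n - l) ->
  let beta := theta / (1 - theta) * (INR k * c * rho) in
  1 - prob_connected n k m l <=
  INR n * exp (beta * (INR l + 1) - theta / INR (k - 1) * INR l).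
Proof.
move=> k1 kn ln c0 theta01 mn nrho beta.
have k0 : 0 < INR (k - 1).
  by apply: (lt_INR 0); apply/ssrnat.ltP; rewrite subn_gt0.
have nl0 : 0 < INR (n - l).
  by apply: (lt_INR 0); apply/ssrnat.ltP; rewrite subn_gt0.
set tau := theta / INR (k - 1).
have tau0 : 0 < tau by apply: Rdiv_lt_0_compat; lra.
have y1 : 1 <= exp tau by have := exp_ineq1_le tau; lra.
have le := prob_disconnected m kn ln y1.
rewrite !exp_pow -subn1 in le.
rewrite (_ : tau * INR (k - 1) = theta) in le; last by rewrite /tau; field; lra.
set x := (exp theta - 1) * _ in le.
have e1 : 0 <= exp theta - 1 <= theta / (1 - theta).
  by have := exp_ineq1_le theta; have := @exp_sub1_le theta; lra.
have k0' : 0 <= INR k := pos_INR k.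
have x0 : 0 <= x.
  by apply: Rmult_le_pos; [lra|apply: Rle_mult_inv_pos].
have xm : x * INR m <= beta.
  have -> : x * INR m = (exp theta - 1) * (INR k * (INR m / INR (n - l))).
    by rewrite /x; field; lra.
  have m0 : 0 <= INR m := pos_INR m.
  have q0 : 0 <= INR m / INR (n - l) by apply: Rle_mult_inv_pos.
  apply: Rmult_le_compat; [lra| by apply: Rmult_le_pos | lra |].
  rewrite Rmult_assoc; apply: Rmult_le_compat_l => //.
  apply: (Rmult_le_reg_r (INR (n - l))) => //.
  rewrite (_ : INR m / INR (n - l) * INR (n - l) = INR m); last by field; lra.
  have := Rmult_le_compat_l c _ _ (Rlt_le _ _ c0) nrho; lra.
have le2 : (1 + x) ^ (m * l.+1)%N <= exp (beta * (INR l + 1)).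
  apply: Rle_trans (pow_le_exp _ x0) _; rewrite mult_INR -Rmult_assoc S_INR.
  have l0 := pos_INR l.
  have [h|<-] := Rmult_le_compat_r (INR l + 1) _ _ ltac:(lra) xm; last exact: Rle_refl.
  exact/Rlt_le/exp_increasing.
apply: (Rmult_le_reg_r (exp (tau * INR l))); first exact: exp_pos.
apply: Rle_trans le _; rewrite Rmult_assoc -exp_plus.
rewrite (_ : _ - _ + _ = beta * (INR l + 1)); last ring.
by apply: Rmult_le_compat_l => //; apply: pos_INR.
Qed.

End Asymptotics.

(** * Choice of constants and the limit *)

Theorem theorem1 (k : nat) (hk : (3 <= k)%N) (c : R)
  (hc0 : Rlt 0 c) (hc1 : Rlt c (Rdiv 1 (Rmult (INR k) (INR (k - 1))))) :
  exists gamma : R, Rlt 0 gamma /\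
    Un_cv (fun n : nat =>
             prob_connected n k (floorR (Rmult c (INR n)))
                                (floorR (Rmult gamma (ln (INR n)))))
          (IZR 1).
Proof.
Local Open Scope R_scope.
have k1 : (1 < k)%N by apply: leq_trans hk.
have k0 : 0 < INR k.
  by apply: (lt_INR 0); apply/ssrnat.ltP; apply: ltnW.
have k10 : 0 < INR (k - 1).
  by apply: (lt_INR 0); apply/ssrnat.ltP; rewrite subn_gt0.
pose q := c * INR k * INR (k - 1).
have q0 : 0 < q by apply: Rmult_lt_0_compat => //; apply: Rmult_lt_0_compat.
have q1 : q < 1.
  have kk : 0 < INR k * INR (k - 1) by apply: Rmult_lt_0_compat.
  have := Rmult_lt_compat_r _ _ _ kk hc1.
  rewrite (_ : 1 / _ * _ = 1) /q; [lra|field; lra].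
(* [r] is midway between [q] and 1, and [rho] puts [q * rho] midway between [q] and [r]. As
   [1 - theta = r], [beta] will be [theta / (k - 1)] times [(q + r) / (2 * r) < 1]; the gap is
   [a]. *)
pose r := (1 + q) / 2; pose theta := 1 - r; pose rho := (q + r) / (2 * q).
have qr : q < r < 1 by rewrite /r; lra.
have theta01 : 0 < theta < 1 by rewrite /theta; lra.
pose a := theta * (r - q) / (2 * r * INR (k - 1)).
have a0 : 0 < a.
  by apply: Rdiv_lt_0_compat; apply: Rmult_lt_0_compat; lra.
have rho1 : 1 < rho.
  apply: (Rmult_lt_reg_r (2 * q)); first lra.
  rewrite /rho (_ : (q + r) / (2 * q) * (2 * q) = q + r); [lra|field; lra].
pose tau := theta / INR (k - 1).
pose beta := theta / (1 - theta) * (INR k * c * rho).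
have betaE : beta = tau - a.
  have -> : beta = theta / r * (q / INR (k - 1) * rho).
    rewrite /beta /q (_ : 1 - theta = r); last by rewrite /theta; ring.
    by field; lra.
  by rewrite /rho /tau /a; field; lra.
(* With this [gamma], [exp (- a * l)] has order [n ^ -2], which beats the factor [n] of the union
   bound. *)
pose gamma := 2 / a; have gamma0 : 0 < gamma by apply: Rdiv_lt_0_compat; lra.
exists gamma; split=> // eps eps0.
pose K := exp tau; have K0 : 0 < K := exp_pos tau.
(* Since [l <= 2 * gamma * sqrt n], having [s <= sqrt n] gives [rho * l <= (rho - 1) * n], that is,
   [n <= rho * (n - l)]. *)
pose s := rho * (2 * gamma) / (rho - 1).
have s0 : 0 < s by apply: Rdiv_lt_0_compat; [apply: Rmult_lt_0_compat|]; lra.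
have [N largeN] : exists N : nat, forall n, (N <= n)%coq_nat ->
    [/\ (k <= n)%N, 1 <= INR n, s * s < INR n & K / eps < INR n].
  have [N1 h1] := INR_unbounded (s * s); have [N2 h2] := INR_unbounded (K / eps).
  exists (k + N1 + N2)%N => n /le_INR; rewrite !plus_INR => le.
  have := pos_INR N1; have := pos_INR N2 => p1 p2.
  split; try lra.
    by apply/ssrnat.leP/INR_le; lra.
  by have := le_INR 1 k (elimT ssrnat.leP (ltnW k1)); rewrite INR_1; lra.
exists N => n /largeN[kn n1 sn Kn].
set l := floorR (gamma * _); set m := floorR (c * _).
have ln0 : 0 <= ln (INR n).
  have [n1'|<-] := n1; last by rewrite ln_1; lra.
  by rewrite -ln_1; apply/Rlt_le/ln_increasing; lra.
have [l1 l2] := floorR_bounds (Rmult_le_pos _ _ (Rlt_le _ _ gamma0) ln0).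
have [_ m2] := floorR_bounds (Rmult_le_pos _ _ (Rlt_le _ _ hc0) (Rle_trans _ _ _ Rle_0_1 n1)).
rewrite -/l in l1 l2; rewrite -/m in m2.
have lsn : INR l * rho <= (rho - 1) * INR n.
  have ssn : s <= sqrt (INR n).
    by rewrite -(sqrt_square s); [apply: sqrt_le_1_alt|]; lra.
  have := ln_le_2sqrt (Rlt_le_trans _ _ _ Rlt_0_1 n1) => lns.
  have := Rmult_le_compat_l gamma _ _ (Rlt_le _ _ gamma0) lns => glns.
  apply: (Rle_trans _ (rho * (2 * gamma) * sqrt (INR n))).
    have : INR l * rho <= gamma * (2 * sqrt (INR n)) * rho by apply: Rmult_le_compat_r; lra.
    lra.
  rewrite -{2}(sqrt_sqrt (INR n)); last lra.
  rewrite (_ : rho * (2 * gamma) = (rho - 1) * s); last by rewrite /s; field; lra.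
  rewrite Rmult_assoc; apply: Rmult_le_compat_l; first lra.
  by apply: Rmult_le_compat_r => //; apply: sqrt_pos.
have ln_n : (l < n)%N.
  apply/ssrnat.ltP/INR_lt; apply: (Rmult_lt_reg_r rho); lra.
have nrho : INR n <= rho * INR (n - l).
  rewrite minus_INR; first lra.
  exact/ssrnat.leP/ltnW.
have := prob_connected_ge k1 kn ln_n hc0 theta01 m2 nrho.
rewrite -/beta -/tau betaE => ge1.
have le1 := prob_connected_le1 m l kn.
have : INR n * exp ((tau - a) * (INR l + 1) - tau * INR l) <= K / INR n.
  (* The left side is [tau - a - a * l]. Rounding [l] down costs at most [a], which the extra [- a]
     from the [l + 1] steps exactly repays. *)
  have e : (tau - a) * (INR l + 1) - tau * INR l <= tau + - (ln (INR n) + ln (INR n)).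
    have h := Rmult_le_compat_l a _ _ (Rlt_le _ _ a0) l1.
    have ag : a * (gamma * ln (INR n) - 1) = 2 * ln (INR n) - a by rewrite /gamma; field; lra.
    lra.
  have {}e : exp ((tau - a) * (INR l + 1) - tau * INR l) <=
      exp (tau + - (ln (INR n) + ln (INR n))).
    by case: e => [e|->]; [apply/Rlt_le/exp_increasing|apply: Rle_refl].
  have n0 : 0 <= INR n by lra.
  apply: Rle_trans (Rmult_le_compat_l _ _ _ n0 e) _.
  rewrite exp_plus exp_Ropp exp_plus exp_ln; last lra.
  by apply: Req_le; rewrite /K; field; lra.
have Keps : K / INR n < eps.
  apply: (Rmult_lt_reg_r (INR n)); first lra.
  rewrite (_ : K / INR n * INR n = K); last by field; lra.
  have := Rmult_lt_compat_r eps _ _ eps0 Kn.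
  rewrite (_ : K / eps * eps = K); [lra|field; lra].
by move=> bound; rewrite /R_dist Rabs_left1; lra.
Qed.
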